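(* Let $G=(V,E)$ be a finite simple graph. Given $v\in V$, let $T$ be a partial Coxeter element that contains $\tau_v$. If $N(v)$ forms a clique in $G$, then the statistic $\psi_v:\mathrm{Ind}(G)\to\mathbb{Z}$ is $1$-mesic on orbits of $T$.
   Context: For a finite simple graph $G=(V,E)$ and $v\in V$, $N(v)$ is the set of neighbors of $v$ (not including $v$). $\mathrm{Ind}(G)$ is the set of all independent sets of $G$ (sets of pairwise nonadjacent vertices). The toggle $\tau_v:\mathrm{Ind}(G)\to\mathrm{Ind}(G)$ is defined by $\tau_v(W)=W\setminus\{v\}$ if $v\in W$; $\tau_v(W)=W\cup\{v\}$ if $v\notin W$ and $W\cup\{v\}\in\mathrm{Ind}(G)$; and $\tau_v(W)=W$ otherwise. A partial Coxeter element is a composition $\tau_{v_1}\tau_{v_2}\cdots\tau_{v_k}$ with $v_1,\dots,v_k\in V$ pairwise distinct; it contains the toggles $\tau_{v_1},\dots,\tau_{v_k}$. Let $\chi_u(W)=1$ if $u\in W$ and $0$ otherwise. Define $\psi_v(W)=2\chi_v(W)+\sum_{u\in N(v)}\chi_u(W)$. A statistic $f$ on a finite set $X$ is $c$-mesic on orbits of a bijection $T:X\to X$ if for every $T$-orbit $\mathcal{O}$ one has $\frac{1}{\#\mathcal{O}}\sum_{x\in\mathcal{O}}f(x)=c$. *)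

(* Defs.v *)
From mathcomp Require Import all_boot all_order all_fingroup all_algebra.

Set Implicit Arguments.
Unset Strict Implicit.
Unset Printing Implicit Defensive.

Import GRing.Theory Num.Theory.
Local Open Scope ring_scope.

(* A finite simple graph is a symmetric irreflexive relation [e] on a finite
   type [V]; the two properties are hypotheses of the theorem, as none of the
   definitions needs them. *)

Definition neighbors (V : finType) (e : rel V) (v : V) : {set V} :=
  [set u | e v u].

Definition clique (V : finType) (e : rel V) (A : {set V}) : Prop :=
  {in A &, forall x y, x != y -> e x y}.

Definition independent (V : finType) (e : rel V) : pred {set V} :=
  fun W => [forall x in W, forall y in W, ~~ e x y].

Notation Ind e := {W : {set _} | independent e W}.

Definition toggle_set (V : finType) (e : rel V) (v : V) (W : {set V}) :
    {set V} :=
  if v \in W then W :\ v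
  else if independent e (v |: W) then v |: W
  else W.

Lemma independentS (V : finType) (e : rel V) (A B : {set V}) :
  A \subset B -> independent e B -> independent e A.
Proof.
move=> /subsetP sAB /forall_inP iB; apply/forall_inP => x xA.
apply/forall_inP => y yA.
by move/forall_inP: (iB x (sAB x xA)) => /(_ y (sAB y yA)).
Qed.

Lemma toggle_set_independent (V : finType) (e : rel V) (v : V) (W : {set V}) :
  independent e W -> independent e (toggle_set e v W).
Proof.
rewrite /toggle_set => iW; case: ifP => [_|_]; last by case: ifP.
exact: independentS (subD1set W v) iW.
Qed.

Definition toggle (V : finType) (e : rel V) (v : V) (W : Ind e) : Ind e :=
  exist _ (toggle_set e v (val W)) (toggle_set_independent v (valP W)).

Lemma toggleK (V : finType) (e : rel V) (v : V) :
  involutive (@toggle V e v).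
Proof.
move=> [W iW]; apply: val_inj => /=; rewrite {2}/toggle_set.
have [vW|vW] := boolP (v \in W).
  by rewrite /toggle_set setD11 setD1K // iW.
case: ifP => iU; first by rewrite /toggle_set setU11 setU1K.
by rewrite /toggle_set (negPf vW) iU.
Qed.

Definition toggle_perm (V : finType) (e : rel V) (v : V) : {perm Ind e} :=
  perm (can_inj (@toggleK V e v)).

(* The composition tau_{v_1} tau_{v_2} ... tau_{v_k} for vs = [v_1; ...; v_k],
   where tau_{v_k} is applied first. The list is reversed because the product
   of {perm _} applies its left factor first. *)
Definition toggle_comp (V : finType) (e : rel V) (vs : seq V) : {perm Ind e} :=
  (\prod_(u <- rev vs) toggle_perm e u)%g.

Lemma toggle_compE (V : finType) (e : rel V) (vs : seq V) (W : Ind e) :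
  toggle_comp e vs W = foldr (@toggle V e) W vs.
Proof.
rewrite /toggle_comp; elim: vs => [|u vs IH] /=; first by rewrite big_nil perm1.
by rewrite rev_cons -cats1 big_cat big_seq1 permM IH permE.
Qed.

Definition partial_coxeter_containing (V : finType) (e : rel V) (v : V)
    (T : {perm Ind e}) : Prop :=
  exists vs : seq V, [/\ uniq vs, v \in vs & T = toggle_comp e vs].

Definition chi (V : finType) (e : rel V) (u : V) (W : Ind e) : int :=
  if u \in val W then 1 else 0.

Definition psi (V : finType) (e : rel V) (v : V) (W : Ind e) : int :=
  2 * chi v W + \sum_(u in neighbors e v) chi u W.

Definition homomesic (X : finType) (T : {perm X}) (f : X -> int) (c : rat) :
    Prop :=
  forall O : {set X}, O \in porbits T ->
    (\sum_(x in O) (f x)%:~R) / #|O|%:R = c.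

(* Main.v *)
Require Import Defs.
From mathcomp Require Import all_boot all_order all_fingroup all_algebra.

(** Write [T = A tau_v B]. Since [N(v)] together with [v] is a clique, an
    independent set [X = B W] meets it in at most one vertex, and [tau_v] inserts
    [v] into [X] exactly when it meets it in none; hence
    [chi_v (T W) + chi_v (B W) + \sum_(u in N(v)) chi_u (B W) = 1].
    Each vertex [u] is toggled at most once, so [chi_u (B W)] is either always
    [chi_u (T W)] or always [chi_u W]; both have the same sum over a [T]-orbit
    as [chi_u]. Summing the displayed identity over an orbit gives the claim. *)

Set Implicit Arguments.
Unset Strict Implicit.
Unset Printing Implicit Defensive.

Import GRing.Theory Num.Theory.
Local Open Scope ring_scope.

(** [T] maps each of its orbits bijectively onto itself. *)
Lemma sum_porbit_perm (X : finType) (T : {perm X}) (M : nmodType) (f : X -> M)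
    (x0 : X) :
  \sum_(x in porbit T x0) f (T x) = \sum_(x in porbit T x0) f x.
Proof.
rewrite [RHS](reindex_inj (@perm_inj _ T)) /=; apply: eq_bigl => x.
by rewrite -!eq_porbit_mem -(porbit_perm T 1 x) expg1.
Qed.

Section Toggles.

Variables (V : finType) (e : rel V).
Implicit Types (u v : V) (s : seq V) (W : Ind e).

Lemma independentP (A : {set V}) :
  reflect {in A &, forall x y, ~~ e x y} (independent e A).
Proof.
apply: (iffP forall_inP) => [iA x y xA yA|iA x xA].
  by move/forall_inP: (iA x xA) => /(_ y yA).
by apply/forall_inP => y; apply: iA.
Qed.

Lemma chi_toggle_neq u v W : u != v -> chi u (toggle v W) = chi u W.
Proof.
move=> uv; rewrite /chi /= /toggle_set.
by case: (v \in val W); case: (independent e (v |: val W)); rewrite ?inE ?uv ?(negPf uv).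
Qed.

Lemma chi_foldr_toggle u s W :
  u \notin s -> chi u (foldr (@toggle V e) W s) = chi u W.
Proof.
elim: s => //= w s IH; rewrite inE negb_or => /andP[uw us].
by rewrite chi_toggle_neq // IH.
Qed.

Hypotheses (e_sym : symmetric e) (e_irr : irreflexive e).

(** Exactly one term is nonzero: the second if [v] is removed, the first if it is inserted, one
    neighbor's if it is blocked. *)
Lemma chi_toggle_clique v W : clique e (neighbors e v) ->
  chi v (toggle v W) + chi v W + \sum_(u in neighbors e v) chi u W = 1.
Proof.
move=> cN; have /independentP iW := valP W.
have nvv : v \notin neighbors e v by rewrite inE e_irr.
rewrite /chi /= /toggle_set.
have [vW|vW] := boolP (v \in val W).
  rewrite setD11 big1 // => u; rewrite inE => vu.
  by case: ifP => // uW; move: (iW _ _ vW uW); rewrite vu.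
have [iU|] := boolP (independent e (v |: val W)).
  rewrite setU11 big1 // => u; rewrite inE => vu.
  case: ifP => // uW; move/independentP: iU => /(_ v u).
  by rewrite setU11 setU1r // vu => /(_ isT isT).
move=> niU; rewrite (negPf vW) !add0r.
(* With no neighbor of [v] in [W], the set [v |: W] would be independent. *)
have [u vu uW] : exists2 u, e v u & u \in val W.
  apply/exists_inP; apply: contraNT niU => /exists_inPn nvW.
  apply/independentP => x y /setU1P[->|xW] /setU1P[->|yW].
  - by rewrite e_irr.
  - by apply: contraL yW => /nvW.
  - by rewrite e_sym; apply: contraL xW => /nvW.
  - exact: iW.
(* A second neighbor of [v] in [W] would be adjacent to [u], by the clique hypothesis. *)
rewrite (bigD1 u) ?inE //= uW big1 ?addr0 // => w /andP[wN wu].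
case: ifP => // wW; move: (iW _ _ wW uW).
by rewrite cN // inE.
Qed.

End Toggles.

Theorem theorem7p5 (V : finType) (e : rel V)
    (e_sym : symmetric e) (e_irr : irreflexive e)
    (v : V) (T : {perm Ind e})
    (T_cox : partial_coxeter_containing v T)
    (N_clique : clique e (neighbors e v)) :
  homomesic T (@psi V e v) 1.
Proof.
case: T_cox => vs [vs_uniq v_vs defT] O /imsetP[W0 _ ->{O}].
case/splitPr: v_vs vs_uniq defT => s1 s2.
rewrite cat_uniq /= negb_or => /and4P[_ /andP[vs1 /hasPn s12] vs2 _] defT.
pose B W := foldr (@toggle V e) W s2.
have TE W : T W = foldr (@toggle V e) (toggle v (B W)) s1.
  by rewrite defT toggle_compE foldr_cat.
set O := porbit T W0.
have sumB u : u != v ->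
    \sum_(W in O) chi u (B W) = \sum_(W in O) chi u W.
  move=> uv; have [us2|us2] := boolP (u \in s2).
    (* By uniqueness [u] is not in [s1], so its state in [B W] is already that in [T W]. *)
    rewrite -[RHS]sum_porbit_perm; apply: eq_bigr => W _.
    by rewrite TE chi_foldr_toggle ?s12 // chi_toggle_neq.
  by apply: eq_bigr => W _; rewrite chi_foldr_toggle.
have sum_psi : \sum_(W in O) psi v W = #|O|%:R.
  rewrite -sum1_card natr_sum.
  (* Of the two copies of [chi v W] in [psi v W], one becomes [chi v (T W)] by orbit invariance, the
     other [chi v (B W)] since [v] is not in [s2]. *)
  transitivity (\sum_(W in O) (chi v (T W) + chi v (B W)
                   + \sum_(u in neighbors e v) chi u (B W))); last first.
    apply: eq_bigr => W _.
    by rewrite TE chi_foldr_toggle // chi_toggle_clique.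
  rewrite /psi !big_split /= sum_porbit_perm.
  congr (_ + _).
    rewrite -big_split; apply: eq_bigr => W _.
    by rewrite chi_foldr_toggle // mulr_natl mulr2n.
  rewrite exchange_big [RHS]exchange_big /=; apply: eq_bigr => u uN.
  rewrite sumB //; apply: contraTneq uN => ->.
  by rewrite inE e_irr.
rewrite -rmorph_sum sum_psi /= rmorph_nat divff // pnatr_eq0 -lt0n.
by apply/card_gt0P; exists W0; apply: porbit_id.
Qed.
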